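(* Let $S$ be a numerical semigroup, let $\{s,s+1\}\subseteq S$, and let $T=2S\cup(\{2s+1\}+2S)$. Then the following conditions hold: (1) $m(T)=2m(S)$; (2) $F(T)=2F(S)+(2s+1)$; (3) $g(T)=2g(S)+s$; (4) $\mathrm{msg}(T)=(2\,\mathrm{msg}(S))\cup\{2s+1\}$; (5) $e(T)=e(S)+1$.
   Context: $\mathbb{N}=\{0,1,2,\ldots\}$. A numerical semigroup is a subset of $\mathbb{N}$ containing $0$, closed under addition and with finite complement in $\mathbb{N}$. For a numerical semigroup $S$: $m(S)=\min(S\setminus\{0\})$; $F(S)=\max(\mathbb{Z}\setminus S)$ (so $F(\mathbb{N})=-1$); $g(S)$ is the cardinality of $\mathbb{N}\setminus S$; $\mathrm{msg}(S)$ is the (unique, finite) minimal system of generators of $S$ as a submonoid of $(\mathbb{N},+)$; $e(S)$ is the cardinality of $\mathrm{msg}(S)$. Notation: $2A=\{2a\mid a\in A\}$ and $A+B=\{a+b\mid a\in A,\ b\in B\}$. The set $T$ is a numerical semigroup.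
   Formalization: Parts (1), (4) and (5) are stated only for s > 0: if s = 0 then S = T = N, and m(T) = 2m(S), msg(T) = 2msg(S) ∪ {2s+1} and e(T) = e(S)+1 all fail; parts (2) and (3) are stated for every s. *)

(* Defs.v *)
From HB Require Import structures.
From mathcomp Require Import all_boot all_order all_algebra finmap.
From mathcomp Require Import mathcomp_extra boolp classical_sets functions.
From mathcomp Require Import cardinality zify.

Set Implicit Arguments.
Unset Strict Implicit.
Unset Printing Implicit Defensive.

Import Order.TTheory GRing.Theory Num.Theory.

Local Open Scope classical_set_scope.

Definition submonoid (M : set nat) : Prop :=
  M 0%N /\ forall a b, M a -> M b -> M (a + b)%N.

Definition numerical_semigroup (S : set nat) : Prop :=
  submonoid S /\ finite_set (~` S).

(* The value is [x0] when the extremum does not exist. *)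
Definition minimum d (T : porderType d) (x0 : T) (A : set T) : T :=
  xget x0 (A `&` lbound A).

Definition maximum d (T : porderType d) (x0 : T) (A : set T) : T :=
  xget x0 (A `&` ubound A).

Definition multiplicity (S : set nat) : nat := minimum 0%N (S `\ 0%N).

(* Taken in the integers, so that the Frobenius number of nat is -1. *)
Definition frobenius (S : set nat) : int :=
  maximum 0%R (~` [set Posz n | n in S]).

Definition genus (S : set nat) : nat := #|` fset_set (~` S)|.

Definition generated_submonoid (A : set nat) : set nat := smallest submonoid A.

Definition minimal_generators (S A : set nat) : Prop :=
  generated_submonoid A = S /\ forall B, B `<` A -> generated_submonoid B <> S.

(* A submonoid of nat has exactly one minimal system of generators, and it is
   finite, so neither the default [set0] nor the value of [fset_set] on
   infinite sets comes into play. *)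
Definition msg (S : set nat) : set nat := xget set0 (minimal_generators S).

Definition embedding_dimension (S : set nat) : nat := #|` fset_set (msg S)|.

Definition twice (A : set nat) : set nat := [set (2 * a)%N | a in A].

Definition sumset (A B : set nat) : set nat :=
  [set (a + b)%N | a in A & b in B].

Lemma numerical_semigroup_twice (S : set nat) (s : nat) :
  numerical_semigroup S -> S s -> S s.+1 ->
  numerical_semigroup
    (twice S `|` sumset [set (2 * s + 1)%N] (twice S)).
Proof.
move=> [[S0 SD] finS] Ss Ss1; split; first split.
- by left; exists 0%N.
- move=> _ _ [[a Sa <-]|[_ -> [_ [a Sa <-] <-]]]
             [[b Sb <-]|[_ -> [_ [b Sb <-] <-]]].
  + by left; exists (a + b)%N; [exact: SD|lia].
  + right; exists (2 * s + 1)%N => //; exists (2 * (a + b))%N; last by lia.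
    by exists (a + b)%N => //; exact: SD.
  + right; exists (2 * s + 1)%N => //; exists (2 * (a + b))%N; last by lia.
    by exists (a + b)%N => //; exact: SD.
  + left; exists ((s + s.+1) + (a + b))%N; last by lia.
    by apply: (SD); exact: SD.
- apply: (@sub_finite_set _ _ (twice (~` S) `|`
    ((fun a => (2 * s + 1 + 2 * a)%N) @` (~` S) `|` `I_(2 * s + 1)))).
    move=> k nTk; have [klt|sk] := ltnP k (2 * s + 1); first by right; right.
    have [odk|evk] := boolP (odd k).
      right; left; exists ((k - (2 * s + 1))./2); last by lia.
      move=> Sa; apply: nTk; right; exists (2 * s + 1)%N => //.
      by exists (2 * (k - (2 * s + 1))./2)%N; [exists (k - (2 * s + 1))./2|lia].
    left; exists k./2; last by lia.
    by move=> Sa; apply: nTk; left; exists k./2 => //; lia.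
  rewrite !finite_setU; split; first exact: finite_image.
  by split; [exact: finite_image|exact: finite_II].
Qed.

(* Main.v *)
(* The even elements of T are 2S and the odd ones are 2s + 1 + 2S, so
   multiplicity, Frobenius number and genus are read off separately on the two
   parity classes. The minimal generators of a submonoid of nat are its atoms,
   the nonzero elements that are not a sum of two nonzero elements. If a is an
   atom of S then 2a is not the sum of two odd elements of T, because a is not
   s plus an element of s + 1 + S: this is where s + 1 in S is used. *)
Require Import Defs.
From mathcomp Require Import all_boot all_order all_algebra finmap.
From mathcomp Require Import boolp classical_sets functions cardinality.
From mathcomp Require Import zify.

Import Order.TTheory.

Local Open Scope classical_set_scope.

(** * Membership in T, by parity *)

Definition doubling (S : set nat) (s : nat) : set nat :=
  twice S `|` sumset [set (2 * s + 1)%N] (twice S).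

Lemma doubling_even (S : set nat) (s a : nat) : doubling S s (2 * a) <-> S a.
Proof.
split=> [[[b Sb eb]|[_ -> [_ [b _ <-] eb]]]|Sa]; last by left; exists a.
  by have -> : a = b by lia.
by lia.
Qed.

Lemma doubling_odd (S : set nat) (s a : nat) :
  doubling S s (2 * s + 1 + 2 * a) <-> S a.
Proof.
split=> [[[b _ eb]|[_ -> [_ [b Sb <-] eb]]]|Sa]; first by lia.
  by have -> : a = b by lia.
by right; exists (2 * s + 1)%N => //; exists (2 * a)%N => //; exists a.
Qed.

Lemma doublingP (S : set nat) (s x : nat) : doubling S s x ->
  (exists2 a, S a & x = (2 * a)%N) \/
  (exists2 a, S a & x = (2 * s + 1 + 2 * a)%N).
Proof.
by case=> [[a Sa <-]|[_ -> [_ [a Sa <-] <-]]]; [left|right]; exists a.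
Qed.

(** * Extrema and multiplicity *)

(** By antisymmetry an extremum is unique, so the choice made by [xget] is forced. *)
Lemma minimumE d (T : porderType d) (x0 x : T) (A : set T) :
  A x -> lbound A x -> minimum x0 A = x.
Proof.
move=> Ax lx; apply: xget_subset1 => // y z [Ay ly] [Az lz].
by apply/eqP; rewrite eq_le ly // lz.
Qed.

Lemma maximumE d (T : porderType d) (x0 x : T) (A : set T) :
  A x -> ubound A x -> maximum x0 A = x.
Proof.
move=> Ax ux; apply: xget_subset1 => // y z [Ay uy] [Az uz].
by apply/eqP; rewrite eq_le uz // uy.
Qed.

Lemma multiplicityE (S : set nat) (m : nat) :
  S m -> (0 < m)%N -> (forall a, S a -> (0 < a)%N -> (m <= a)%N) ->
  multiplicity S = m.
Proof.
move=> Sm m0 minm; apply: minimumE => [|a [Sa /= a0]].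
  by split=> //= me; rewrite me in m0.
by rewrite leEnat; apply: minm => //; rewrite lt0n; apply/eqP.
Qed.

Lemma multiplicity_min (S : set nat) (s : nat) : S s -> (0 < s)%N ->
  [/\ S (multiplicity S), (0 < multiplicity S)%N
    & forall a, S a -> (0 < a)%N -> (multiplicity S <= a)%N].
Proof.
move=> Ss s0; have ex : exists a, `[< S a >] && (0 < a)%N.
  by exists s; rewrite s0 andbT; apply/asboolP.
case: (ex_minnP ex) => m /andP[/asboolP Sm m0] minm.
have minm' a : S a -> (0 < a)%N -> (m <= a)%N.
  by move=> Sa a0; apply: minm; rewrite a0 andbT; apply/asboolP.
by rewrite (multiplicityE _ _ Sm m0 minm').
Qed.

Lemma multiplicity_doubling (S : set nat) (s : nat) : S s -> (0 < s)%N ->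
  multiplicity (doubling S s) = (2 * multiplicity S)%N.
Proof.
move=> Ss s0; have [Sm m0 minm] := multiplicity_min _ _ Ss s0.
apply: multiplicityE => [||_ /doublingP[] [a Sa ->] a0].
- exact/doubling_even.
- by lia.
- by have := minm a Sa; lia.
(* An odd element exceeds [2 * s], and [multiplicity S <= s]. *)
- by have := minm s Ss s0; lia.
Qed.

(** * Frobenius number *)

Lemma finite_nat_bounded (A : set nat) : finite_set A ->
  exists n, forall k, A k -> (k < n)%N.
Proof.
move=> finA; exists (\max_(i <- fset_set A) i).+1 => k Ak.
by rewrite ltnS leq_bigmax_seq // in_fset_set // inE.
Qed.

(** Here [n] is the conductor. For [n = 0] the second hypothesis is vacuous and the value is -1, as
    -1 is then the largest integer outside [S]. *)
Lemma frobeniusE (S : set nat) (n : nat) :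
  (forall k, (n <= k)%N -> S k) -> (forall k, n = k.+1 -> ~ S k) ->
  frobenius S = (Posz n - 1)%R.
Proof.
move=> Sn nSn; apply: maximumE => [/= [k Sk ek]|z nSz].
  by apply: (nSn k) => //; lia.
rewrite leNgt; apply/negP => nz; apply: nSz.
by exists (absz z); [apply: Sn|]; lia.
Qed.

(** Take the least [n] past which everything lies in [S]: if its predecessor were in [S], that
    predecessor would be a smaller such bound. *)
Lemma conductor (S : set nat) : numerical_semigroup S ->
  exists n, (forall k, (n <= k)%N -> S k) /\ (forall k, n = k.+1 -> ~ S k).
Proof.
move=> [_ /finite_nat_bounded[N bN]].
have ex : exists n, `[< forall k, (n <= k)%N -> S k >].
  by exists N; apply/asboolP => k Nk; apply: contrapT => /bN; lia.
case: (ex_minnP ex) => n /asboolP Sn minn; exists n; split=> // k nk Sk.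
suff : (n <= k)%N by lia.
apply: minn; apply/asboolP => j; rewrite leq_eqVlt => /orP[/eqP <- //|kj].
by apply: Sn; lia.
Qed.

Lemma frobenius_doubling (S : set nat) (s : nat) : numerical_semigroup S ->
  frobenius (doubling S s) = (2 * frobenius S + Posz (2 * s + 1)%N)%R.
Proof.
move=> /conductor[n [Sn nSn]]; rewrite (frobeniusE _ _ Sn nSn).
(* Even numbers belong to T from [2 * n] on and odd ones from [2 * s + 1 + 2 * n] on; the odd number
   just below the latter is [2 * n + 2 * s - 1]. *)
rewrite (frobeniusE _ (2 * n + 2 * s)); first by lia.
  move=> k nk; have [ok|ek] := boolP (odd k).
    have -> : k = (2 * s + 1 + 2 * (k - (2 * s + 1))./2)%N by lia.
    by apply/doubling_odd/Sn; lia.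
  have -> : k = (2 * k./2)%N by lia.
  by apply/doubling_even/Sn; lia.
move=> k ek /doublingP[] [a Sa ka]; first by lia.
by apply: (nSn a) => //; lia.
Qed.

(** * Genus *)

Lemma card_fset_set_image (T U : choiceType) (f : T -> U) (A : set T) :
  injective f -> finite_set A -> #|` fset_set (f @` A)| = #|` fset_set A|.
Proof. by move=> injf finA; rewrite fset_set_image // card_imfset. Qed.

Lemma card_fset_set_disjointU (T : choiceType) (A B : set T) :
  finite_set A -> finite_set B -> (forall x, A x -> ~ B x) ->
  #|` fset_set (A `|` B)| = (#|` fset_set A| + #|` fset_set B|)%N.
Proof.
move=> finA finB AB; rewrite fset_setU // -cardfsUI -fset_setI //.
suff -> : A `&` B = set0 by rewrite fset_set0 cardfs0 addn0.
by apply/seteqP; split=> // x [/AB].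
Qed.

Lemma genus_doubling (S : set nat) (s : nat) : numerical_semigroup S ->
  genus (doubling S s) = (2 * genus S + s)%N.
Proof.
move=> [_ finS]; rewrite /genus.
(* Each gap of [S] yields one even and one odd gap of T; the other gaps are the [s] odd numbers
   below [2 * s + 1]. *)
have -> : ~` doubling S s = ((fun a => (2 * a)%N) @` (~` S) `|`
    (fun a => (2 * s + 1 + 2 * a)%N) @` (~` S)) `|`
    (fun a => (2 * a + 1)%N) @` `I_s.
  apply/seteqP; split=> [k nTk|_ [[]|] [a /= Sa <-] Ta].
  - have [ok|ek] := boolP (odd k).
      have [klt|sk] := ltnP k (2 * s + 1).
        by right; exists k./2 => /=; lia.
      have kE : k = (2 * s + 1 + 2 * (k - (2 * s + 1))./2)%N by lia.
      left; right; exists (k - (2 * s + 1))./2 => //= Sa.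
      by apply: nTk; rewrite kE; apply/doubling_odd.
    have kE : k = (2 * k./2)%N by lia.
    left; left; exists k./2 => //= Sa.
    by apply: nTk; rewrite kE; apply/doubling_even.
  - by move/doubling_even: Ta.
  - by move/doubling_odd: Ta.
  - by case/doublingP: Ta => -[b _]; lia.
rewrite !card_fset_set_disjointU ?card_fset_set_image ?finite_setU;
  do ?[split]; do ?[exact: finite_image | exact: finite_II
                   | by move=> a b /=; lia | exact: finS].
- by rewrite (card_fset_set (card_eqxx `I_s)); lia.
- by move=> _ [a _ <-] [b _]; lia.
- by move=> _ [] [a _ <-] [b /=]; lia.
Qed.

(** * Minimal generators and embedding dimension *)

Definition atoms (S : set nat) : set nat :=
  [set x | [/\ S x, (0 < x)%N & forall a b, S a -> S b -> x = (a + b)%N ->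
                                 a = 0%N \/ b = 0%N]].

Lemma submonoid_generated (A : set nat) : submonoid (generated_submonoid A).
Proof.
split=> [M [[M0 _] _] //|a b ga gb M CM].
by case: (CM) => [[_ MD] _]; exact: MD (ga M CM) (gb M CM).
Qed.

(** Strong induction: a nonzero element that is not an atom splits into two smaller elements of
    [S]. *)
Lemma generated_atoms (S : set nat) :
  submonoid S -> generated_submonoid (atoms S) = S.
Proof.
move=> subS; have [S0 SD] := subS.
have [G0 GD] := submonoid_generated (atoms S).
apply/seteqP; split; first by apply: smallest_sub => // x [].
move=> x; have [n] := ubnP x; elim: n x => // n IH x xn Sx.
have [->//|x0] := eqVneq x 0%N.
have [ax|nax] := pselect (atoms S x); first exact: sub_gen_smallest.
have [a [b [Sa Sb xab a0 b0]]] :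
    exists a b, [/\ S a, S b, x = (a + b)%N, (0 < a)%N & (0 < b)%N].
  apply: contrapT => nex; apply: nax; split=> // [|a b Sa Sb xab]; first by lia.
  case: (posnP a) => [|a0]; first by left.
  case: (posnP b) => [|b0]; first by right.
  by case: nex; exists a, b.
by rewrite xab; apply: GD; apply: IH => //; lia.
Qed.

(* [S `\ x] is a submonoid when [x] is an atom. *)
Lemma atoms_sub_generators (S A : set nat) :
  submonoid S -> generated_submonoid A = S -> atoms S `<=` A.
Proof.
move=> [S0 SD] gA x [Sx x0 irr]; apply: contrapT => nAx.
suff : generated_submonoid A `<=` S `\ x.
  by rewrite gA => /(_ x Sx) [_ /(_ erefl)].
apply: smallest_sub => [|y Ay].
  split=> [|a b [Sa ax] [Sb bx]]; first by split=> //= e; rewrite -e in x0.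
  split=> [|abx]; first exact: SD.
  by case: (irr a b Sa Sb (esym abx)) => e; [apply: bx|apply: ax];
     rewrite /= -abx e ?addn0.
split; first by rewrite -gA; exact: sub_gen_smallest.
by move=> yx; apply: nAx; rewrite -yx.
Qed.

(** The atoms generate [S] and lie in every generating set, so no other generating set is
    minimal. *)
Lemma msg_atoms (S : set nat) : submonoid S -> msg S = atoms S.
Proof.
move=> subS; have minP A : minimal_generators S A -> A = atoms S.
  move=> [gA minA]; have sA := atoms_sub_generators _ _ subS gA.
  apply: contrapT => nA; apply: (minA (atoms S)); last exact: generated_atoms.
  by rewrite properEneq; split=> //; apply/eqP => e; apply: nA.
apply: xget_subset1 => [|A B /minP -> /minP -> //].
split=> [|B [_ nAB] gB]; first exact: generated_atoms.
by apply: nAB; apply: atoms_sub_generators.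
Qed.

Lemma finite_msg (S : set nat) : numerical_semigroup S -> finite_set (msg S).
Proof.
move=> nsS; have [n [Sn _]] := conductor _ nsS.
rewrite msg_atoms; last exact: nsS.1.
apply: (@sub_finite_set _ _ `I_(2 * n + 2)); last exact: finite_II.
move=> x [_ _ irr] /=; rewrite ltnNge; apply/negP => nx.
(* Both summands are at least [n.+1], hence in [S] and nonzero even if [n = 0]. *)
by case: (irr n.+1 (x - n.+1)%N); [apply: Sn|apply: Sn|..]; lia.
Qed.

Lemma msg_doubling (S : set nat) (s : nat) :
  numerical_semigroup S -> S s -> S s.+1 -> (0 < s)%N ->
  msg (doubling S s) = twice (msg S) `|` [set (2 * s + 1)%N].
Proof.
move=> nsS Ss Ss1 s0; have [[S0 SD] _] := nsS.
have [subT _] := numerical_semigroup_twice nsS Ss Ss1.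
rewrite !msg_atoms; [|by case: nsS|exact: subT].
have T2s1 : doubling S s (2 * s + 1).
  by have := (doubling_odd S s 0).2 S0; rewrite muln0 addn0.
apply/seteqP; split=> [x [Tx x0 irr]|_ [[a [Sa a0 irr] <-]|->]].
- case/doublingP: (Tx) => -[a Sa xa].
    left; exists a => //; split=> // [|b c Sb Sc abc]; first by lia.
    by case: (irr (2 * b) (2 * c))%N;
      [exact/doubling_even|exact/doubling_even|..]; lia.
  (* An odd [x] is [2 * s + 1] plus [2 * a], both in T, so irreducibility forces [a = 0]. *)
  right; case: (irr (2 * s + 1) (2 * a))%N => //= [||e]; try by lia.
  exact/doubling_even.
- split; [exact/doubling_even|by lia|].
  move=> _ _ /doublingP[] [b Sb ->] /doublingP[] [c Sc ->] abc; try by lia.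
    by case: (irr b c) => //; lia.
  (* A sum of two odd elements of T is [2 * (s + (s.+1 + b + c))]. *)
  have := irr s (s.+1 + (b + c))%N Ss (SD _ _ Ss1 (SD _ _ Sb Sc)).
  by lia.
(* One of two summands of [2 * s + 1] is odd, hence at least [2 * s + 1], and the other is 0. *)
- split=> // [|_ _ /doublingP[] [b _ ->] /doublingP[] [c _ ->]]; by lia.
Qed.

Lemma embedding_dimension_doubling (S : set nat) (s : nat) :
  numerical_semigroup S -> S s -> S s.+1 -> (0 < s)%N ->
  embedding_dimension (doubling S s) = (embedding_dimension S + 1)%N.
Proof.
move=> nsS Ss Ss1 s0; have finm := finite_msg _ nsS.
rewrite /embedding_dimension msg_doubling // card_fset_set_disjointU //.
- rewrite fset_set1 cardfs1 card_fset_set_image //.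
  by move=> a b /=; lia.
- exact: finite_image.
- by move=> _ [a _ <-] /=; lia.
Qed.

(* For s = 0 the hypotheses force S = T = nat, and then (1), (4) and (5) are
   false while (2) and (3) hold: hence the conditions 0 < s. *)
Theorem proposition48 (S : set nat) (s : nat) :
  numerical_semigroup S -> S s -> S s.+1 ->
  let T := twice S `|` sumset [set (2 * s + 1)%N] (twice S) in
  [/\ (0 < s)%N -> multiplicity T = (2 * multiplicity S)%N,
      frobenius T = (2 * frobenius S + Posz (2 * s + 1)%N)%R,
      genus T = (2 * genus S + s)%N,
      (0 < s)%N -> msg T = twice (msg S) `|` [set (2 * s + 1)%N]
    & (0 < s)%N -> embedding_dimension T = (embedding_dimension S + 1)%N].
Proof.
move=> nsS Ss Ss1 /=; split.
- exact: multiplicity_doubling.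
- exact: frobenius_doubling.
- exact: genus_doubling.
- exact: msg_doubling.
- exact: embedding_dimension_doubling.
Qed.
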